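(* Let $(X,d_X)$ and $(I,d_I)$ be two arbitrary pseudo-distance spaces. Suppose that $\mathscr{C}$ is a nonempty set of nonempty subsets of $X$, and that $(A_t)_{t\in I}$ is a family of subsets in $\mathscr{C}$ (that is, $A_t\in\mathscr{C}$ for each $t\in I$). Given $f:X\to\mathbb{R}$, define $\phi^*:I\to[-\infty,\infty]$ and $\phi_*:I\to[-\infty,\infty]$ by $\phi^*(t):=\mathrm{SUP}_f(A_t)=\sup\{f(x):x\in A_t\}$ and $\phi_*(t):=\mathrm{INF}_f(A_t)=\inf\{f(x):x\in A_t\}$ for each $t\in I$. Then the following two statements hold. (a) Assume that for each $A\in\mathscr{C}$ there is $r_A>0$ such that $B[A,r_A]\in\mathscr{C}$. Assume also that $f$ is uniformly continuous on each $A\in\mathscr{C}$, and that for each $t_0\in I$ one has $\limsup_{t\to t_0}D_{H,X}(A_{t_0},A_t)\leq 0$. If $A_t\in\mathrm{dom}(\mathrm{SUP}_f)$ for all $t\in I$, then $\phi^*$ is a continuous function from $I$ to $\mathbb{R}$; and if $A_t\in\mathrm{dom}(\mathrm{INF}_f)$ for every $t\in I$, then $\phi_*$ is a continuous function from $I$ to $\mathbb{R}$. (b) Assume that $\mathscr{C}$ has the following two properties: first, for each $C_1,C_2\in\mathscr{C}$ there is $C_{1,2}\in\mathscr{C}$ such that $C_1\cup C_2\subseteq C_{1,2}$; second, $f$ is $\Lambda(C)$-Lipschitz continuous on each $C\in\mathscr{C}$ for some $\Lambda(C)>0$. Assume also that for all $t,s\in I$ there is some $\alpha_{t,s}>0$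 such that $D_{H,X}(A_t,A_s)\leq\alpha_{t,s}d_I(t,s)$. If $A_t\in\mathrm{dom}(\mathrm{SUP}_f)$ for all $t\in I$, then for all $t,s\in I$ there is some $\Lambda_{t,s}>0$ such that $|\phi^*(t)-\phi^*(s)|\leq\alpha_{t,s}\Lambda_{t,s}d_I(t,s)$. In particular, if $A_t\in\mathrm{dom}(\mathrm{SUP}_f)$ for all $t\in I$, $f$ is $\Lambda$-Lipschitz continuous on $X$ (with $\Lambda>0$), and there is some $\alpha>0$ such that $D_{H,X}(A_t,A_s)\leq\alpha d_I(t,s)$ for all $t,s\in I$, then $\phi^*$ is $\alpha\Lambda$-Lipschitz continuous on $I$. Similarly, if $A_t\in\mathrm{dom}(\mathrm{INF}_f)$ for every $t\in I$, then for all $t,s\in I$ there is some $\Lambda_{t,s}>0$ such that $|\phi_*(t)-\phi_*(s)|\leq\alpha_{t,s}\Lambda_{t,s}d_I(t,s)$. In particular, if $A_t\in\mathrm{dom}(\mathrm{INF}_f)$ for every $t\in I$, $f$ is $\Lambda$-Lipschitz continuous on $X$ (with $\Lambda>0$), and there is some $\alpha>0$ such that $D_{H,X}(A_t,A_s)\leq\alpha d_I(t,s)$ for all $t,s\in I$, then $\phi_*$ is $\alpha\Lambda$-Lipschitz continuous on $I$.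
   Context: A pseudo-distance space $(X,d)$ is a nonempty set $X$ with an arbitrary function $d:X^2\to[-\infty,\infty]$ (no symmetry, nonnegativity, finiteness or triangle inequality is assumed). For $f:X\to\mathbb{R}$ and $A\subseteq X$: $\mathrm{SUP}_f(A):=\sup\{f(a):a\in A\}$, $\mathrm{INF}_f(A):=\inf\{f(a):a\in A\}$; $\mathrm{dom}(\mathrm{SUP}_f)$ (resp. $\mathrm{dom}(\mathrm{INF}_f)$) is the set of all $A\subseteq X$ for which $\mathrm{SUP}_f(A)\in\mathbb{R}$ (resp. $\mathrm{INF}_f(A)\in\mathbb{R}$). For $x\in X$ and nonempty $A,A'\subseteq X$: $d_X(x,A):=\inf\{d_X(x,a):a\in A\}$; for $r>0$, $B[A,r]:=\{x\in X:d_X(x,A)\leq r\}$; $D_{asyH}(A,A'):=\sup\{d_X(a,A'):a\in A\}$; and $D_{H,X}(A,A'):=\max\{D_{asyH}(A,A'),D_{asyH}(A',A)\}$ (the Hausdorff distance induced by $d_X$). $\limsup_{t\to t_0}D_{H,X}(A_{t_0},A_t)\leq 0$ means: for every $\epsilon>0$ there exists $\delta>0$ such that for all $t\in I$ with $d_I(t_0,t)<\delta$ one has $D_{H,X}(A_{t_0},A_t)<\epsilon$. Let $g$ be a real function on a pseudo-distance space $(Z,\rho)$ and $\emptyset\neq A\subseteq Z$. $g$ is continuous at $x\in Z$ if for every $\epsilon>0$ there is $\delta>0$ such that $|g(x)-g(y)|<\epsilon$ for each $y\in Z$ with $\rho(x,y)<\delta$; $g$ is continuous if it is continuous at each point. $g$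 is uniformly continuous on $A$ if for each $\epsilon>0$ there is $\delta>0$ such that $|g(x)-g(y)|<\epsilon$ for all $(x,y)\in A^2$ with $\rho(x,y)<\delta$. $g$ is $\Lambda$-Lipschitz continuous on $A$ if $|g(x)-g(y)|\leq\Lambda\rho(x,y)$ for all $(x,y)\in A^2$.
   Formalization: Part (a) adds the hypothesis that D_{H,X}(A_t,A_t) ≤ 0 for all t in I; without it (a) fails for pseudo-distances with positive self-distances. It is automatic if d_X(x,x) ≤ 0 for all x, or if d_I(t,t) ≤ 0 for all t. *)

(* Defs.v *)
From mathcomp Require Import all_boot all_order all_algebra.
From mathcomp Require Import all_classical all_reals ereal.

Set Implicit Arguments.
Unset Strict Implicit.
Unset Printing Implicit Defensive.

Import Order.TTheory GRing.Theory Num.Theory.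
Local Open Scope classical_set_scope.
Local Open Scope ring_scope.
Local Open Scope ereal_scope.

(* No axiom on [pdist]: it may be asymmetric, negative or infinite, also on
   the diagonal. *)
Record pseudoDistSpace (R : realType) := PseudoDistSpace {
  pdist_sort :> Type;
  pdist : pdist_sort -> pdist_sort -> \bar R;
  pdist_nonempty : inhabited pdist_sort
}.

Section OneSpace.
Variables (R : realType) (X : pseudoDistSpace R).
Implicit Types (f g : X -> R) (A B : set X) (x y : X).

Definition SUP f A : \bar R := ereal_sup [set (f a)%:E | a in A].
Definition INF f A : \bar R := ereal_inf [set (f a)%:E | a in A].

Definition domSUP f : set (set X) := [set A | SUP f A \is a fin_num].
Definition domINF f : set (set X) := [set A | INF f A \is a fin_num].

Definition dist_to x A : \bar R := ereal_inf [set pdist x a | a in A].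

Definition Bset A (r : R) : set X := [set x | dist_to x A <= r%:E].

Definition D_asyH A B : \bar R := ereal_sup [set dist_to a B | a in A].
Definition D_H A B : \bar R := maxe (D_asyH A B) (D_asyH B A).

Definition pd_continuous_at g x : Prop :=
  forall eps : R, (0 < eps)%R -> exists2 delta : R, (0 < delta)%R &
    forall y, pdist x y < delta%:E -> (`|g x - g y| < eps)%R.

Definition pd_continuous g : Prop := forall x, pd_continuous_at g x.

Definition pd_unif_continuous_on A g : Prop :=
  forall eps : R, (0 < eps)%R -> exists2 delta : R, (0 < delta)%R &
    forall x y, A x -> A y -> pdist x y < delta%:E -> (`|g x - g y| < eps)%R.

Definition pd_lipschitz_on A (L : R) g : Prop :=
  forall x y, A x -> A y -> `|g x - g y|%:E <= L%:E * pdist x y.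

(* An extended-real function on X is a continuous (resp. Lipschitz) function
   from X to R: it takes only finite values, and the real function [fine \o h]
   it then is has the property. *)
Definition real_continuous (h : X -> \bar R) : Prop :=
  (forall x, h x \is a fin_num) /\ pd_continuous (fine \o h).

Definition real_lipschitz (L : R) (h : X -> \bar R) : Prop :=
  (forall x, h x \is a fin_num) /\ pd_lipschitz_on setT L (fine \o h).

End OneSpace.

Section Families.
Variables (R : realType) (X I : pseudoDistSpace R).

(* limsup_{t -> t0} D_H (A t0) (A t) <= 0 *)
Definition limsup_D_H_le0 (A : I -> set X) (t0 : I) : Prop :=
  forall eps : R, (0 < eps)%R -> exists2 delta : R, (0 < delta)%R &
    forall t : I, pdist t0 t < delta%:E -> D_H (A t0) (A t) < eps%:E.

End Families.

(* Main.v *)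
Require Import Defs.
From mathcomp Require Import all_boot all_order all_algebra.
From mathcomp Require Import all_classical all_reals ereal.

(** Every modulus of continuity of [f] passes to [SUP f] and [INF f] over sets
    measured by the Hausdorff distance.  If [D_H A B < c], then each point of
    [A] has a point of [B] at distance less than [c] from it, and conversely
    ([D_H_ltP]).  When [f] varies by at most [e] between points of [A `|` B] at
    distance less than [c], the sets of values of [f] on [A] and [B] are thus
    within [e] of each other, and so are their suprema ([SUP_close]) and, on
    passing to [- f], their infima ([INF_close]).

    For (a), the modulus is that of [f] on [B[A_t0, r]]: this set belongs to
    the class, and contains [A_t] as soon as [D_H (A t0) (A t) <= r]; it
    contains [A_t0] because [D_H (A t0) (A t0) <= 0].  For (b), the modulus is
    [e = L * c], on a member of the class containing [A_t `|` A_s] or on the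
    whole space; letting the real [c] decrease to the bound on [D_H (A t) (A s)]
    gives the Lipschitz estimate ([le_of_Lipschitz_modulus]). *)

Import Order.TTheory GRing.Theory Num.Theory.

Local Open Scope classical_set_scope.
Local Open Scope ring_scope.
Local Open Scope ereal_scope.

Section Closeness.
Context {R : realType} {X : pseudoDistSpace R}.
Implicit Types (f : X -> R) (A B K : set X) (e c L : R).

Definition values_approx f e A B :=
  forall a, A a -> exists2 b, B b & (`|f a - f b| <= e)%R.

Lemma D_asyH_lt_approx A B c : D_asyH A B < c%:E ->
  forall a, A a -> exists2 b, B b & pdist a b < c%:E.
Proof.
move=> ABc a Aa.
have : dist_to a B < c%:E.
  by apply: le_lt_trans ABc; apply: ereal_sup_ubound; exists a.
by move=> /ereal_inf_lt[_ [b Bb <-] abc]; exists b.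
Qed.

Lemma D_H_ltP A B c : D_H A B < c%:E ->
  (forall a, A a -> exists2 b, B b & pdist a b < c%:E) /\
  (forall b, B b -> exists2 a, A a & pdist b a < c%:E).
Proof.
by rewrite /D_H gt_max => /andP[ABc BAc]; split; exact: D_asyH_lt_approx.
Qed.

(** The balls in part (a) are measured towards the set, and so is
    [D_asyH B A]; this is why it is the second half of [D_H A B] that bounds
    [B]. *)
Lemma D_H_le_sub_Bset A B r : D_H A B <= r%:E -> B `<=` Bset A r.
Proof.
rewrite /D_H ge_max => /andP[_ BAr] b Bb; rewrite /Bset /=.
by apply: le_trans BAr; apply: ereal_sup_ubound; exists b.
Qed.

Lemma D_H_lt_values_approx f K A B c e :
  A `<=` K -> B `<=` K ->
  (forall x y, K x -> K y -> pdist x y < c%:E -> (`|f x - f y| <= e)%R) ->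
  D_H A B < c%:E -> values_approx f e A B /\ values_approx f e B A.
Proof.
move=> AK BK fce /D_H_ltP[AB BA]; split=> [a Aa|b Bb].
- by have [b Bb abc] := AB a Aa; exists b => //; apply: fce => //; auto.
- by have [a Aa bac] := BA b Bb; exists a => //; apply: fce => //; auto.
Qed.

Lemma SUP_le_approx f e A B :
  values_approx f e A B -> SUP f A <= SUP f B + e%:E.
Proof.
move=> AB; apply: ge_ereal_sup => _ [a Aa <-].
have [b Bb fab] := AB a Aa.
apply: (@le_trans _ _ ((f b)%:E + e%:E)).
  by rewrite -EFinD lee_fin -lerBlDl (le_trans (ler_norm _)).
by apply: leeD2r; apply: ereal_sup_ubound; exists b.
Qed.

Lemma SUP_close f e A B : domSUP f A -> domSUP f B ->
  values_approx f e A B -> values_approx f e B A ->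
  `|SUP f A - SUP f B| <= e%:E.
Proof.
rewrite /domSUP /= => finA finB /SUP_le_approx + /SUP_le_approx.
move: finA finB; case: (SUP f A) => [a| |] // _.
case: (SUP f B) => [b| |] // _; rewrite /= !lee_fin => ab ba.
by rewrite ler_norml lerBlDl ab lerNl opprB lerBlDl ba.
Qed.

Lemma INF_SUPN f A : INF f A = - SUP (fun x => - f x)%R A.
Proof. by rewrite /INF /SUP /ereal_inf image_comp. Qed.

Lemma domINF_SUPN f A : domINF f A = domSUP (fun x => - f x)%R A.
Proof. by rewrite /domINF /domSUP /= INF_SUPN fin_numN. Qed.

Lemma values_approxN f e A B :
  values_approx f e A B -> values_approx (fun x => - f x)%R e A B.
Proof.
by move=> AB a /AB[b Bb fab]; exists b; rewrite // -opprD normrN.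
Qed.

Lemma INF_close f e A B : domINF f A -> domINF f B ->
  values_approx f e A B -> values_approx f e B A ->
  `|INF f A - INF f B| <= e%:E.
Proof.
rewrite !domINF_SUPN => finA finB AB BA; rewrite !INF_SUPN.
by rewrite oppeK addeC; apply: SUP_close => //; apply: values_approxN.
Qed.

Lemma lipschitz_D_H_values_approx f K L A B c : (0 < L)%R ->
  pd_lipschitz_on K L f -> A `<=` K -> B `<=` K -> D_H A B < c%:E ->
  values_approx f (L * c) A B /\ values_approx f (L * c) B A.
Proof.
move=> L0 fL AK BK; apply: (D_H_lt_values_approx f K) => // x y Kx Ky xyc.
rewrite -lee_fin EFinM (le_trans (fL x y Kx Ky)) //.
by apply: lee_wpmul2l; [rewrite lee_fin ltW | exact: ltW].
Qed.

End Closeness.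

(** Real radii [c] are used because [m] may be infinite.  An [m] equal to
    [-oo] is excluded, since [c := -1] would give [0 <= - L]. *)
Lemma le_of_Lipschitz_modulus {R : realType} (L : R) (u m : \bar R) :
  (0 < L)%R -> 0 <= u ->
  (forall c : R, m < c%:E -> u <= (L * c)%:E) -> u <= L%:E * m.
Proof.
move=> L0 u0; case: m => [r| |] uc.
- apply/lee_addgt0Pr => e e0.
  have : r%:E < (r + e / L)%:E by rewrite lte_fin ltrDl divr_gt0.
  by move=> /uc; rewrite mulrDr mulrCA divff ?gt_eqF // mulr1 EFinD EFinM.
- by rewrite gt0_muley ?lte_fin // leey.
- have /(le_trans u0) := uc (-1)%R (ltNyr _).
  by rewrite lee_fin mulrN1 oppr_ge0 leNgt L0.
Qed.

(** The estimates common to the supremum and the infimum: [Phi] is either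
    set function, and [Phi_close] is [SUP_close] or [INF_close]. *)
Section SetFunction.
Context {R : realType} {X I : pseudoDistSpace R}.
Variables (f : X -> R) (Phi : set X -> \bar R).
Hypothesis Phi_close : forall (e : R) (S T : set X),
  Phi S \is a fin_num -> Phi T \is a fin_num ->
  values_approx f e S T -> values_approx f e T S -> `|Phi S - Phi T| <= e%:E.

Lemma Phi_lipschitz (K A B : set X) (L a : R) (d : \bar R) : (0 < L)%R ->
  pd_lipschitz_on K L f -> A `<=` K -> B `<=` K ->
  Phi A \is a fin_num -> Phi B \is a fin_num -> D_H A B <= a%:E * d ->
  `|Phi A - Phi B| <= (a * L)%:E * d.
Proof.
move=> L0 fL AK BK finA finB ABd.
rewrite mulrC EFinM -muleA; apply: le_of_Lipschitz_modulus => // c dc.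
have [] := lipschitz_D_H_values_approx f K L A B c L0 fL AK BK.
  exact: le_lt_trans dc.
exact: Phi_close.
Qed.

Variables (C : set (set X)) (A : I -> set X).
Hypothesis A_in_C : forall t, C (A t).
Hypothesis Phi_fin : forall t, Phi (A t) \is a fin_num.

Lemma Phi_continuous :
  (forall t, D_H (A t) (A t) <= 0) ->
  (forall K, C K -> exists2 r : R, (0 < r)%R & C (Bset K r)) ->
  (forall K, C K -> pd_unif_continuous_on K f) ->
  (forall t0, limsup_D_H_le0 A t0) ->
  real_continuous (fun t => Phi (A t)).
Proof.
move=> AA0 ballC fC A_cont; split=> // t0 eps eps0 /=.
have [r r0 CK] := ballC _ (A_in_C t0).
(* half of [eps] because passing to the supremum loses strictness *)
have eps2 : (0 < eps / 2)%R by rewrite divr_gt0.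
have [c c0 fc] := fC _ CK _ eps2.
have [|delta delta0 near_t0] := A_cont t0 (Num.min r c); first by rewrite lt_min r0.
exists delta => // t /near_t0 DH.
have [DHr DHc] : D_H (A t0) (A t) < r%:E /\ D_H (A t0) (A t) < c%:E.
  by split; apply: (lt_le_trans DH); rewrite lee_fin ge_min lexx ?orbT.
have [||x y Kx Ky xyc|approx approx'] :=
    D_H_lt_values_approx f (Bset (A t0) r) (A t0) (A t) c (eps / 2) _ _ _ DHc.
- by apply: D_H_le_sub_Bset; apply: le_trans (AA0 t0) _; rewrite lee_fin ltW.
- by apply: D_H_le_sub_Bset; exact: ltW.
- by apply: ltW; exact: fc.
have := Phi_close _ _ _ (Phi_fin t0) (Phi_fin t) approx approx'.
rewrite -[Phi (A t0)]fineK // -[Phi (A t)]fineK // lee_fin /= => le_eps2.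
by apply: le_lt_trans le_eps2 _; rewrite ltr_pdivrMr // ltr_pMr // ltr1n.
Qed.

Lemma Phi_locally_lipschitz (alpha : I -> I -> R) :
  (forall K1 K2, C K1 -> C K2 -> exists2 K12, C K12 & K1 `|` K2 `<=` K12) ->
  (forall K, C K -> exists2 L : R, (0 < L)%R & pd_lipschitz_on K L f) ->
  (forall t s, (0 < alpha t s)%R /\
     D_H (A t) (A s) <= (alpha t s)%:E * pdist t s) ->
  forall t s, exists2 L : R, (0 < L)%R &
    `|Phi (A t) - Phi (A s)| <= (alpha t s * L)%:E * pdist t s.
Proof.
move=> unionC fC DH t s.
have [K CK tsK] := unionC _ _ (A_in_C t) (A_in_C s).
have [L L0 fL] := fC K CK; exists L => //.
apply: (Phi_lipschitz K) (DH t s).2 => //.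
- by move=> x Ax; apply: tsK; left.
- by move=> x Ax; apply: tsK; right.
Qed.

Lemma Phi_real_lipschitz (L a : R) : (0 < L)%R -> pd_lipschitz_on setT L f ->
  (forall t s, D_H (A t) (A s) <= a%:E * pdist t s) ->
  real_lipschitz (a * L) (fun t => Phi (A t)).
Proof.
move=> L0 fL DH; split=> // t s _ _ /=.
have := Phi_lipschitz setT _ _ L a _ L0 fL _ _ (Phi_fin t) (Phi_fin s) (DH t s).
rewrite -[Phi (A t)]fineK // -[Phi (A s)]fineK //=; exact.
Qed.

End SetFunction.

(* The hypothesis [D_H (A t) (A t) <= 0] in the first part is not in the
   original statement, which is false without it when the diagonals of both
   pseudo-distances are arbitrary: let X and I both be the two-point space
   {0, 1} with d(x, y) = 0 for x <> y and d(x, x) = +oo, let C = {{0}, {1}},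
   A_t = {t}, f(0) = 1, f(1) = 0 and r_A = 1.  The hypothesis is automatic if
   d_X(x, x) <= 0 for all x, and also (by the limsup hypothesis at t = t0) if
   d_I(t, t) <= 0 for all t. *)
Theorem corollary4p1 (R : realType) (X I : pseudoDistSpace R)
    (C : set (set X)) (A : I -> set X) (f : X -> R)
    (C_neq0 : C !=set0)
    (C_sets_neq0 : forall K : set X, C K -> K !=set0)
    (A_in_C : forall t : I, C (A t)) :
  let phi_sup := fun t : I => SUP f (A t) in
  let phi_inf := fun t : I => INF f (A t) in
  (* (a) *)
  ((forall t : I, D_H (A t) (A t) <= 0) ->
   (forall K : set X, C K -> exists2 r : R, (0 < r)%R & C (Bset K r)) ->
   (forall K : set X, C K -> pd_unif_continuous_on K f) ->
   (forall t0 : I, limsup_D_H_le0 A t0) ->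
   ((forall t : I, domSUP f (A t)) -> real_continuous phi_sup) /\
   ((forall t : I, domINF f (A t)) -> real_continuous phi_inf)) /\
  (* (b) *)
  (forall alpha : I -> I -> R,
   (forall K1 K2 : set X, C K1 -> C K2 ->
      exists2 K12 : set X, C K12 & K1 `|` K2 `<=` K12) ->
   (forall K : set X, C K ->
      exists2 L : R, (0 < L)%R & pd_lipschitz_on K L f) ->
   (forall t s : I, (0 < alpha t s)%R /\
      D_H (A t) (A s) <= (alpha t s)%:E * pdist t s) ->
   [/\ (forall t : I, domSUP f (A t)) ->
       forall t s : I, exists2 L : R, (0 < L)%R &
         `|phi_sup t - phi_sup s| <= (alpha t s * L)%:E * pdist t s,
       (forall t : I, domSUP f (A t)) ->
       forall L a : R, (0 < L)%R -> pd_lipschitz_on setT L f ->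
         (0 < a)%R ->
         (forall t s : I, D_H (A t) (A s) <= a%:E * pdist t s) ->
         real_lipschitz (a * L) phi_sup,
       (forall t : I, domINF f (A t)) ->
       forall t s : I, exists2 L : R, (0 < L)%R &
         `|phi_inf t - phi_inf s| <= (alpha t s * L)%:E * pdist t s
     & (forall t : I, domINF f (A t)) ->
       forall L a : R, (0 < L)%R -> pd_lipschitz_on setT L f ->
         (0 < a)%R ->
         (forall t s : I, D_H (A t) (A s) <= a%:E * pdist t s) ->
         real_lipschitz (a * L) phi_inf]).
Proof.
move=> phi_sup phi_inf.
have supC e S T := @SUP_close R X f e S T.
have infC e S T := @INF_close R X f e S T.
split=> [AA0 ballC fC A_cont|alpha unionC fC DH].
  split=> fin.
  - exact: (Phi_continuous f (SUP f) supC C A).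
  - exact: (Phi_continuous f (INF f) infC C A).
split=> fin.
- exact: (Phi_locally_lipschitz f (SUP f) supC C A).
- by move=> L a L0 fL _ DHa; exact: (Phi_real_lipschitz f (SUP f) supC A).
- exact: (Phi_locally_lipschitz f (INF f) infC C A).
- by move=> L a L0 fL _ DHa; exact: (Phi_real_lipschitz f (INF f) infC A).
Qed.
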